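(* Let $d > 2$ be an integer. For every integer $k\ge 0$, the $d^{k+1}\times d^{k+1}$ diagonal matrix $\mathbf{I}_k \oplus \mathbf{\Omega}_k \oplus \cdots \oplus \mathbf{\Omega}_k^{d-1}$ (the direct sum of the powers $\mathbf{\Omega}_k^{\ell-1}$, $\ell = 1,\ldots,d$) admits the decomposition $$\mathbf{I}_k \oplus \mathbf{\Omega}_k \oplus \cdots \oplus \mathbf{\Omega}_k^{d-1} = \prod_{i=1}^{k} \left( \sum_{\ell=1}^{d} E_\ell \otimes \mathbf{I}_{i-1} \otimes R_{i+1}^{\ell-1} \otimes \mathbf{I}_{k-i} \right).$$
   Context: $\otimes$ denotes the Kronecker product of matrices, and $\oplus$ the block-diagonal direct sum of square matrices. $\mathbf{I}_m$ denotes the $d^m\times d^m$ identity matrix (so $\mathbf{I}_0=[1]$). For an integer $m\ge 0$, $\omega_{d^m} := \exp\left(\frac{-2\pi \mathrm{i}}{d^m}\right)$. For $k\ge 0$, $\mathbf{\Omega}_k$ is the $d^k\times d^k$ diagonal matrix $\mathbf{\Omega}_k := \mathrm{diag}\left(\omega_{d^{k+1}}^{0}, \omega_{d^{k+1}}^{1}, \ldots, \omega_{d^{k+1}}^{d^k-1}\right)$. For $m\ge 1$, $R_m$ is the $d\times d$ diagonal matrix $R_m := \mathrm{diag}\left(\omega_{d^m}^0, \omega_{d^m}^1,\ldots,\omega_{d^m}^{d-1}\right)$. $E_\ell := e_\ell e_\ell^T$, where $e_1,\ldots,e_d$ is the standard basis of $\mathbb{C}^d$. The empty product ($k=0$) is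 the identity matrix. *)

(* Defs.v *)
From HB Require Import structures.
From mathcomp Require Import all_boot all_order all_algebra.
From mathcomp Require Import complex mxtens.
From mathcomp Require Import reals sequences exp trigo.

Set Implicit Arguments.
Unset Strict Implicit.
Unset Printing Implicit Defensive.

Import Order.TTheory GRing.Theory Num.Theory.
Local Open Scope ring_scope.
Local Open Scope complex_scope.

(* The complex exponential, e^(a + ib) = e^a (cos b + i sin b); real numbers  *)
(* are an arbitrary [realType] R, and complex numbers are R[i].               *)
Definition cexp (R : realType) (z : R[i]) : R[i] :=
  (expR (complex.Re z))%:C * (cos (complex.Im z) +i* sin (complex.Im z)).

Lemma cexp_real (R : realType) (x : R) : cexp x%:C = (expR x)%:C.
Proof. by rewrite /cexp /= cos0 sin0 mulr1. Qed.

Lemma cexpD (R : realType) (z w : R[i]) : cexp (z + w) = cexp z * cexp w.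
Proof.
case: z w => [a b] [c e]; rewrite /cexp /= expRD cosD sinD.
rewrite mulrACA -rmorphM; congr (_ * _).
by congr (_ +i* _); rewrite addrC [cos b * _]mulrC.
Qed.

Definition omega (R : realType) (d m : nat) : R[i] :=
  cexp (- 2 * pi%:C * 'i%C / (d ^ m)%:R).

Definition Imx (R : realType) (d m : nat) : 'M[R[i]]_(d ^ m) := 1%:M.

Definition Omegamx (R : realType) (d k : nat) : 'M[R[i]]_(d ^ k) :=
  diag_mx (\row_(j < d ^ k) omega R d k.+1 ^+ j).

Definition Rmx (R : realType) (d m : nat) : 'M[R[i]]_d :=
  diag_mx (\row_(j < d) omega R d m ^+ j).

(* The standard basis is indexed from 0: [Emx R l] is E_(l+1).                *)
Definition stdbasis (R : realType) (d : nat) (l : 'I_d) : 'cV[R[i]]_d :=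
  delta_mx l 0.

Definition Emx (R : realType) (d : nat) (l : 'I_d) : 'M[R[i]]_d :=
  stdbasis R l *m (stdbasis R l)^T.

(* Transport along a provable equality of sizes; entries are unchanged.       *)
Definition castsqmx (T : Type) (m n : nat) (e : m = n) (A : 'M[T]_m) : 'M[T]_n :=
  castmx (e, e) A.

Lemma dsum_dim (d k : nat) : (\sum_(l < d) d ^ k = d ^ k.+1)%N.
Proof. by rewrite sum_nat_const card_ord expnS. Qed.

(* For [i : 'I_k] counted from 0, the sizes of E, I_i, R_(i+2), I_(k-i-1).    *)
Lemma factor_dim (d k : nat) (i : 'I_k) :
  (d * d ^ i * d * d ^ (k - i.+1) = d ^ k.+1)%N.
Proof. by rewrite -expnS -expnSr -expnD addSn subnKC. Qed.

(* Main.v *)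
(* Every matrix involved is diagonal, so the identity is one between diagonal *)
(* entries.  Write the index as l d^k + j with j < d^k, and let c_0 ...       *)
(* c_(k-1) be the base-d digits of j, most significant first.  The left-hand  *)
(* entry is w_(d^(k+1))^(j l), the i-th factor on the right contributes       *)
(* w_(d^(i+2))^(c_i l), and j = \sum_i c_i d^(k-1-i) together with            *)
(* w_(d^(m+1))^d = w_(d^m) makes both sides agree.                            *)

Require Import Defs.
From mathcomp Require Import all_boot all_order all_algebra.
From mathcomp Require Import complex mxtens reals.
From mathcomp Require Import sequences exp trigo.

Import Order.TTheory GRing.Theory Num.Theory.

Local Open Scope ring_scope.

(** [ndiag_tens] and [mxdiag_ndiag] reduce both sides to scalar functions of the index [a]. In each
    factor [Emx] selects the block [a %/ d ^ k]; what remains, [prod_omega_digits], is the base-d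
    expansion of [a %% d ^ k] read in the exponent. *)

Lemma cexp0 (R : realType) : cexp (0 : R[i]) = 1.
Proof. by rewrite -[0](rmorph0 (real_complex R)) cexp_real expR0 rmorph1. Qed.

Lemma cexpMn (R : realType) (z : R[i]) n : cexp (z *+ n) = cexp z ^+ n.
Proof.
elim: n => [|n IHn]; first by rewrite mulr0n expr0 cexp0.
by rewrite mulrS cexpD IHn exprS.
Qed.

Lemma omegaSX (R : realType) d m : (0 < d)%N ->
  omega R d m.+1 ^+ d = omega R d m.
Proof.
move=> d_gt0; rewrite /omega -cexpMn; congr cexp.
have d_neq0 : d%:R != 0 :> R[i] by rewrite pnatr_eq0 -lt0n.
by rewrite -[_ *+ d]mulr_natr expnSr natrM invfM mulrA divfK.
Qed.

(* Diagonal matrices given by a function on nat, so that changing the size    *)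
(* along an equality does not affect the entries.                             *)
Definition ndiag {V : nmodType} n (f : nat -> V) : 'M[V]_n :=
  diag_mx (\row_(j < n) f j).

Lemma eq_ndiag (V : nmodType) n (f g : nat -> V) :
  (forall j, (j < n)%N -> f j = g j) -> ndiag n f = ndiag n g.
Proof. by move=> fg; congr diag_mx; apply/rowP => j; rewrite !mxE fg. Qed.

Lemma castsqmx_ndiag (V : nmodType) m n (e : m = n) (f : nat -> V) :
  castsqmx e (ndiag m f) = ndiag n f.
Proof. by case: n / e; rewrite /castsqmx castmx_id. Qed.

Lemma ndiag1 (K : pzRingType) n : ndiag n (fun=> 1 : K) = 1%:M.
Proof. by apply/matrixP => i j; rewrite !mxE. Qed.

Lemma ndiagM (K : pzRingType) n (f g : nat -> K) :
  ndiag n f *m ndiag n g = ndiag n (fun j => f j * g j).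
Proof. by rewrite mulmx_diag; congr diag_mx; apply/rowP => j; rewrite !mxE. Qed.

Lemma ndiagX (K : pzRingType) n (f : nat -> K) l :
  ndiag n f ^+ l = ndiag n (fun j => f j ^+ l).
Proof.
elim: l => [|l IHl]; first by rewrite expr0 -[1]ndiag1.
rewrite exprS IHl -[_ * _]/(_ *m _) ndiagM.
by apply: eq_ndiag => j _; rewrite exprS.
Qed.

Lemma ndiag_sum (V : nmodType) n (I : finType) (f : I -> nat -> V) :
  \sum_i ndiag n (f i) = ndiag n (fun j => \sum_i f i j).
Proof.
apply/matrixP => a b; rewrite summxE !mxE -sumrMnl.
by apply: eq_bigr => i _; rewrite !mxE.
Qed.

Lemma ndiag_prod (K : pzRingType) n (I : Type) (r : seq I) (f : I -> nat -> K) :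
  \prod_(i <- r) ndiag n (f i) = ndiag n (fun j => \prod_(i <- r) f i j).
Proof.
elim: r => [|i r IHr].
  by rewrite big_nil -[1]ndiag1; apply: eq_ndiag => j _; rewrite big_nil.
rewrite big_cons IHr -[_ * _]/(_ *m _) ndiagM.
by apply: eq_ndiag => j _; rewrite big_cons.
Qed.

(** The Kronecker index of the pair (q, r) is q n + r, and two indices agree exactly when both
    components do. *)
Lemma ndiag_tens (K : pzRingType) m n (f g : nat -> K) :
  ndiag m f *t ndiag n g = ndiag (m * n) (fun a => f (a %/ n)%N * g (a %% n)%N).
Proof.
apply/matrixP => a b; rewrite !mxE mulrnAl mulrnAr -!mulrnA mulnb.
congr (_ *+ nat_of_bool _); apply/andP/eqP => [[/eqP q /eqP r]|-> //].
by rewrite -[a]mxtens_unindexK -[b]mxtens_unindexK; congr mxtens_index;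
  exact/pair_equal_spec.
Qed.

Lemma mxdiag_ndiag (K : pzRingType) p n (f : nat -> nat -> K) :
  \mxdiag_(l < p) ndiag n (f l) =
  ndiag (\sum_(l < p) n) (fun a => f (a %/ n)%N (a %% n)%N).
Proof.
rewrite /ndiag -diag_mxrow; congr diag_mx; apply/rowP => s; rewrite !mxE.
rewrite -[in RHS](tagnat.sig2K s) tagnat.RankEsum.
set l := tagnat.sig1 s; set j := tagnat.sig2 s.
have n_gt0 : (0 < n)%N by apply: leq_ltn_trans (ltn_ord j).
(* Block [l] starts after [l] blocks of size [n]. *)
rewrite (_ : \sum_(_ < _ | _) n = l * n)%N; last first.
  rewrite -(big_ord_widen p (fun=> n) (ltnW (ltn_ord l))).
  by rewrite sum_nat_const card_ord.
by rewrite divnMDl // modnMDl divn_small // modn_small // addn0.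
Qed.

Lemma Emx_ndiag (R : realType) d (l : 'I_d) :
  Emx R l = ndiag d (fun j => (j == l)%:R).
Proof.
rewrite /Emx /stdbasis trmx_delta mul_delta_mx; apply/matrixP => a b.
rewrite !mxE -mulrnA mulnb -!val_eqE /=; case: (a =P b :> nat) => [->|];
  by do 2![case: eqP => //= ?]; congruence.
Qed.

(** Induction on [k], for all [a]: the last factor carries the lowest digit [a %% d], the others the
    digits of [a %/ d], and [omegaSX] brings both to one root of unity. *)
Lemma prod_omega_digits (R : realType) d k l a : (0 < d)%N ->
  \prod_(i < k) omega R d i.+2 ^+ ((a %/ d ^ (k - i.+1)) %% d * l) =
  omega R d k.+1 ^+ (a %% d ^ k * l).
Proof.
move=> d_gt0; elim: k a => [|k IHk] a; first by rewrite big_ord0 modn1.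
rewrite big_ord_recr /= subnn divn1.
under eq_bigr => i _ do rewrite subSn ?ltn_ord // expnS divnMA.
rewrite IHk -(omegaSX R d k.+1) // -exprM -exprD mulnA -mulnDl.
suff -> : (a %% d ^ k.+1 = d * ((a %/ d) %% d ^ k) + a %% d)%N by [].
have dk_gt0 : (0 < d ^ k)%N by rewrite expn_gt0 d_gt0.
rewrite {1}(divn_eq a d) {1}(divn_eq (a %/ d) (d ^ k)) mulnDl -mulnA -expnSr.
rewrite -addnA modnMDl [(_ * d)%N]mulnC modn_small //.
rewrite expnSr -ltn_divLR // divnDl ?dvdn_mulr // mulKn //.
by rewrite [((a %% d) %/ d)%N]divn_small ?ltn_mod // addn0 ltn_mod.
Qed.

(* Both l and i are counted from 0: they stand for l - 1 and i - 1. *)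
Theorem theorem6 (R : realType) (d k : nat) (hd : (2 < d)%N) :
  castsqmx (dsum_dim d k) (\mxdiag_(l < d) (Omegamx R d k ^+ l)) =
  \prod_(i < k)
    castsqmx (factor_dim d i)
      (\sum_(l < d)
         Emx R l *t Imx R d i *t (Rmx R d i.+2 ^+ l) *t Imx R d (k - i.+1)).
Proof.
have d_gt0 : (0 < d)%N by apply: leq_trans hd.
under eq_mxdiag => l.
  rewrite /Omegamx -/(ndiag _ (fun j => omega R d k.+1 ^+ j)) ndiagX; over.
rewrite (mxdiag_ndiag _ d (d ^ k) (fun l j => (omega R d k.+1 ^+ j) ^+ l)).
rewrite castsqmx_ndiag.
under eq_bigr => i _.
  under eq_bigr => l _.
    rewrite Emx_ndiag /Imx -!ndiag1 /Rmx.
    rewrite -/(ndiag _ (fun j => omega R d i.+2 ^+ j)) ndiagX !ndiag_tens.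
    over.
  rewrite ndiag_sum castsqmx_ndiag; over.
rewrite ndiag_prod; apply: eq_ndiag => a a_lt /=.
rewrite -exprM -prod_omega_digits //; apply: eq_bigr => i _.
have q_lt : (a %/ d ^ k < d)%N by rewrite ltn_divLR ?expn_gt0 ?d_gt0 // -expnS.
have q_eq : (a %/ d ^ (k - i.+1) %/ d %/ d ^ i = a %/ d ^ k)%N.
  by rewrite -!divnMA -expnS -expnD subnK.
(* Only the term whose [l] is the leading digit of [a] survives. *)
rewrite (bigD1 (Ordinal q_lt)) //= q_eq eqxx big1 => [|l /negPf l_neq].
  by rewrite addr0 !mulr1 mul1r exprM.
by rewrite -val_eqE /= eq_sym in l_neq; rewrite l_neq !mul0r.
Qed.
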